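(* If a nonconstant Boolean function $f:\mathbb{F}_2^n\to\mathbb{F}_2$ is $s$-plateaued for some nonnegative integer $s$, then the $2$-coloring $f$ of the vertices of the subspace hypergraph $\mathcal{D}_n$ is perfect.
   Context: For a Boolean function $f:\mathbb{F}_2^n\to\mathbb{F}_2$, the Fourier transform is $\widehat f(x)=\frac{1}{2^{n/2}}\sum_{z\in\mathbb{F}_2^n}(-1)^{f(z)+(x,z)}$ with $(x,z)=x_1z_1+\dots+x_nz_n$. $f$ is $s$-plateaued if $\widehat f(x)\in\{0,\pm2^{s/2}\}$ for all $x$. The subspace hypergraph $\mathcal{D}_n$ is the $4$-uniform hypergraph with vertex set $\mathbb{F}_2^n$ whose hyperedges are the $4$-element sets $\{x,y,z,v\}$ (of distinct vectors) with $x+y+z+v=\overline 0$. A $2$-coloring of a hypergraph is a surjective function $f$ from the vertex set onto a $2$-element set of colors. The color range of a hyperedge $e$ is the multiset $\{f(x):x\in e\}$. The coloring is perfect if for any two vertices $x,y$ of the same color, the multisets of color ranges of hyperedges incident to $x$ and of hyperedges incident to $y$ coincide. *)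

(* Defs.v *)
From HB Require Import structures.
From mathcomp Require Import all_boot all_order all_algebra.
From mathcomp Require Import finmap multiset.

Set Implicit Arguments.
Unset Strict Implicit.
Unset Printing Implicit Defensive.

Import Order.TTheory GRing.Theory Num.Theory.
Local Open Scope ring_scope.
Local Open Scope mset_scope.

(* The vectors of F_2^n are the row vectors 'rV['F_2]_n; n = 0 is allowed. *)
Definition boolfun (n : nat) := 'rV['F_2]_n -> 'F_2.

Definition nonconstant (n : nat) (f : boolfun n) : Prop :=
  ~ exists c : 'F_2, forall x, f x = c.

Definition dotF2 (n : nat) (x z : 'rV['F_2]_n) : 'F_2 :=
  \sum_(i < n) x 0 i * z 0 i.

(* 2 to the real power k / 2, k possibly odd. *)
Definition pow2half (R : rcfType) (k : nat) : R := Num.sqrt 2 ^+ k.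

(* The exponent of -1 is the representative in {0, 1} of an element of F_2. *)
Definition fourier (R : rcfType) (n : nat) (f : boolfun n)
    (x : 'rV['F_2]_n) : R :=
  (pow2half R n)^-1 *
  \sum_(z : 'rV['F_2]_n) (-1) ^+ nat_of_ord (f z + dotF2 x z).

Definition plateaued (R : rcfType) (n s : nat) (f : boolfun n) : Prop :=
  forall x, fourier R f x \in [:: 0; pow2half R s; - pow2half R s].

(* Hyperedges over V, without repetition; V itself is the vertex set. *)
Definition hypergraph (V : finType) := {set {set V}}.

Definition subspace_hypergraph (n : nat) : hypergraph 'rV['F_2]_n :=
  [set e : {set 'rV['F_2]_n} | (#|e| == 4)%N & \sum_(x in e) x == 0].

Definition is_coloring (V C : finType) (k : nat) (f : V -> C) : Prop :=
  #|C| = k /\ forall c : C, exists x : V, f x = c.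

Definition color_range (V C : finType) (f : V -> C) (e : {set V}) : {mset C} :=
  seq_mset [seq f x | x <- enum e].

Definition incident_ranges (V C : finType) (H : hypergraph V) (f : V -> C)
    (x : V) : {mset {mset C}} :=
  seq_mset [seq color_range f e | e <- enum [set e in H | x \in e]].

Definition perfect_coloring (V C : finType) (k : nat) (H : hypergraph V)
    (f : V -> C) : Prop :=
  is_coloring k f /\
  forall x y : V, f x = f y -> incident_ranges H f x = incident_ranges H f y.

(* Main.v *)
Require Import Defs.
From HB Require Import structures.
From mathcomp Require Import all_boot all_order all_algebra.
From mathcomp Require Import finmap multiset.
From mathcomp Require Import ring lra.

(** Put F x = (-1)^(f x) and let W u = sum_z F z * (-1)^(u, z) be its
unnormalised Fourier transform. Plateauedness says that W takes only the values
0 and +-m for one m, hence W^3 = m^2 * W pointwise. Inverting the transform, the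
triple convolution sum_(y, z) F y * F z * F (x + y + z) equals m^2 * F x
([plateaued_convolution]): it depends on x only through its colour.

This is the only non-trivial correlation one needs. The number of pairs (y, z)
for which (f y, f z, f (x + y + z)) is a prescribed triple of colours is a sum
of products of indicators, and the indicator of f y = a is
(1 + (-1)^a * F y) / 2. Expanding the product leaves the triple convolution and
terms in which at least one of the three factors F is missing; the arguments of
the remaining factors then vary independently over the whole space, so such a
term does not depend on x at all.
Hence these pair counts depend only on f x ([plateaued_pattern_sum]). The
degenerate pairs, with y = x, z = x or y = z, are removed by inclusion-exclusion:
then x + y + z is one of the three vectors, and the corrections also depend only
on f x ([plateaued_distinct_pattern_sum]).

Finally, a hyperedge through x is a set {x, y, z, x + y + z} with x, y, z
distinct, and it comes from exactly 6 ordered pairs (y, z) ([count_edges]). So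
the number of hyperedges at x with a given colour range is one sixth of such a
pair count, hence depends only on f x. *)

Set Implicit Arguments.
Unset Strict Implicit.
Unset Printing Implicit Defensive.

Import Order.TTheory GRing.Theory Num.Theory.
Local Open Scope ring_scope.

(** * Vectors and signs over the two-element field *)

Lemma F2P (a : 'F_2) : a = 0 \/ a = 1.
Proof. by case: a => [[|[|m]] //= ?]; [left | right]; apply/val_inj. Qed.

Lemma addvv (n : nat) (x : 'rV['F_2]_n) : x + x = 0.
Proof.
by apply/rowP => i; rewrite !mxE; case: (F2P (x 0 i)) => ->; apply/val_inj.
Qed.

Lemma addv_eq0 (n : nat) (x y : 'rV['F_2]_n) : (x + y == 0) = (x == y).
Proof. by rewrite -(inj_eq (addIr y)) -addrA addvv addr0 add0r. Qed.

Section Characters.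

Variable R : realFieldType.

Definition sgnF2 (a : 'F_2) : R := (-1) ^+ nat_of_ord a.

Lemma sgnF2D (a b : 'F_2) : sgnF2 (a + b) = sgnF2 a * sgnF2 b.
Proof.
by rewrite /sgnF2; case: (F2P a) => ->; case: (F2P b) => -> /=; ring.
Qed.

(** Indicators as combinations of signs: this is what turns counting colour
patterns into computing correlations of the sign function of f. *)
Lemma eq_sgnF2 (a b : 'F_2) : (a == b)%:R = (1 + sgnF2 a * sgnF2 b) / 2.
Proof.
rewrite /sgnF2; case: (F2P a) => ->; case: (F2P b) => -> /=.
all: by rewrite /= ?expr0 ?expr1; field.
Qed.

(** * Characters and Fourier inversion *)

Variable n : nat.
Implicit Types u w x y z v : 'rV['F_2]_n.

Definition chi u z : R := sgnF2 (dotF2 u z).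

Lemma chiDl u w z : chi (u + w) z = chi u z * chi w z.
Proof.
rewrite /chi -sgnF2D /dotF2 -big_split /=; congr sgnF2.
by apply: eq_bigr => i _; rewrite mxE mulrDl.
Qed.

Lemma chiDr u w z : chi u (w + z) = chi u w * chi u z.
Proof.
rewrite /chi -sgnF2D /dotF2 -big_split /=; congr sgnF2.
by apply: eq_bigr => i _; rewrite mxE mulrDr.
Qed.

(** Orthogonality of characters: when w has a nonzero coordinate i, translating
u by the i-th basis vector changes the sign of every term. *)
Lemma sum_chi w : \sum_u chi u w = #|{: 'rV['F_2]_n}|%:R * (w == 0)%:R.
Proof.
have [->|/rV0Pn[i wi]] := eqVneq w 0.
  rewrite mulr1 -sum1_card natr_sum; apply: eq_bigr => u _.
  by rewrite /chi /dotF2 big1 // => i _; rewrite mxE mulr0.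
rewrite mulr0; pose e : 'rV['F_2]_n := delta_mx 0 i.
have chi_e : chi e w = -1.
  rewrite /chi /dotF2 (bigD1 i) //= big1 => [|j ji]; last first.
    by rewrite !mxE (negbTE ji) andbF mul0r.
  by case: (F2P (w 0 i)) wi => -> //; rewrite !mxE !eqxx.
suff : \sum_u chi u w = - \sum_u chi u w by move=> /eqP; rewrite -subr_eq0; lra.
rewrite {1}(reindex_inj (addIr e)) /= -sumrN; apply: eq_bigr => u _.
by rewrite chiDl chi_e mulrN1.
Qed.

(** Fourier inversion for the cube: a pointwise product of transforms is the
transform of a convolution, and orthogonality keeps only the quadruples of
vectors with sum zero. *)
Lemma sum_chi3 (h : 'rV['F_2]_n -> R) x :
  \sum_u (\sum_z h z * chi u z) ^+ 3 * chi u x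
  = #|{: 'rV['F_2]_n}|%:R * \sum_y \sum_z h y * h z * h (x + y + z).
Proof.
transitivity (\sum_y \sum_z \sum_v h y * h z * h v *
                \sum_u chi u ((x + y + z) + v)).
  transitivity (\sum_u \sum_y \sum_z \sum_v
      h y * h z * h v * chi u (x + y + z + v)).
    apply: eq_bigr => u _.
    rewrite 2!exprS expr1 -mulrA mulr_suml; apply: eq_bigr => y _.
    rewrite mulrCA -mulrA mulr_suml; apply: eq_bigr => z _.
    rewrite mulr_suml mulr_sumr; apply: eq_bigr => v _.
    by rewrite !chiDr; ring.
  rewrite exchange_big; apply: eq_bigr => y _.
  rewrite exchange_big; apply: eq_bigr => z _.
  rewrite exchange_big; apply: eq_bigr => v _.
  by rewrite mulr_sumr.
rewrite mulr_sumr; apply: eq_bigr => y _.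
rewrite mulr_sumr; apply: eq_bigr => z _.
rewrite (bigD1 (x + y + z)) //= [X in _ + X]big1 => [|v vxyz].
  by rewrite sum_chi addvv eqxx mulr1 addr0; ring.
by rewrite sum_chi addv_eq0 eq_sym (negbTE vxyz) !mulr0.
Qed.

Lemma sum_chi1 (h : 'rV['F_2]_n -> R) x :
  \sum_u (\sum_z h z * chi u z) * chi u x = #|{: 'rV['F_2]_n}|%:R * h x.
Proof.
transitivity (\sum_z h z * \sum_u chi u (x + z)).
  transitivity (\sum_u \sum_z h z * chi u (x + z)).
    apply: eq_bigr => u _; rewrite mulr_suml; apply: eq_bigr => z _.
    by rewrite chiDr; ring.
  by rewrite exchange_big; apply: eq_bigr => z _; rewrite mulr_sumr.
rewrite (bigD1 x) //= [X in _ + X]big1 => [|z zx].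
  by rewrite sum_chi addvv eqxx mulr1 addr0; ring.
by rewrite sum_chi addv_eq0 eq_sym (negbTE zx) !mulr0.
Qed.

Lemma card_rV_neq0 : #|{: 'rV['F_2]_n}|%:R != 0 :> R.
Proof. by rewrite pnatr_eq0 -lt0n; apply/card_gt0P; exists 0. Qed.

(** Any two of y, z, x + y + z run independently over the whole space, so only the
product of all three values of g can depend on x. *)
Lemma sum_product_expand (g : 'rV['F_2]_n -> R) (a b d : R) x :
  let N := #|{: 'rV['F_2]_n}|%:R in let S := \sum_y g y in
  \sum_y \sum_z (1 + a * g y) * (1 + b * g z) * (1 + d * g (x + y + z))
  = N * N + (a + b + d) * (N * S) + (a * b + a * d + b * d) * (S * S)
    + a * b * d * \sum_y \sum_z g y * g z * g (x + y + z).
Proof.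
move=> N S.
have sumS t : \sum_z g (t + z) = S by rewrite [RHS](reindex_inj (addrI t)).
have sum_cst (k : R) : \sum_(z : 'rV['F_2]_n) k = N * k.
  by rewrite sumr_const mulr_natl.
pose Q y := \sum_z g z * g (x + y + z).
have sumQ : \sum_y Q y = S * S.
  rewrite exchange_big /= mulr_suml; apply: eq_bigr => z _.
  rewrite -mulr_sumr -(sumS (x + z)); congr (_ * _).
  by apply: eq_bigr => y _; rewrite addrAC.
have sum_z y : \sum_z (1 + a * g y) * (1 + b * g z) * (1 + d * g (x + y + z))
    = (N + (b + d) * S) + a * (N + (b + d) * S) * g y
      + b * d * Q y + a * b * d * (g y * Q y).
  transitivity ((1 + a * g y) * (\sum_(z : 'rV['F_2]_n) 1 + b * \sum_z g z
      + d * \sum_z g (x + y + z) + b * d * Q y)).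
    rewrite !mulr_sumr -!big_split mulr_sumr.
    by apply: eq_bigr => z _ /=; ring.
  by rewrite sum_cst sumS -/S; ring.
under eq_bigr => y _ do rewrite sum_z.
rewrite !big_split /= -!mulr_sumr sumQ -/S !sum_cst.
have -> : \sum_y g y * Q y = \sum_y \sum_z g y * g z * g (x + y + z).
  apply: eq_bigr => y _; rewrite mulr_sumr.
  by apply: eq_bigr => z _; rewrite mulrA.
by ring.
Qed.

End Characters.

(** * Colour patterns of plateaued functions *)

(** Inclusion-exclusion over the three conditions y = x, z = x and y = z: any two
of them imply the third, so the four intersections coincide, which is where the
coefficient 3 - 1 = 2 comes from. *)
Lemma sum_distinct_pairs (A : comNzRingType) (V : finType)
    (G : V -> V -> A) x :
  \sum_y \sum_z [&& y != x, z != x & y != z]%:R * G y z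
  = \sum_y \sum_z G y z - \sum_y G y y - \sum_y G y x - \sum_z G x z
    + 2 * G x x.
Proof.
have pick (h : V -> A) t : \sum_z (z == t)%:R * h z = h t.
  by rewrite (bigD1 t) //= eqxx mul1r big1 ?addr0 // => z /negbTE->;
    rewrite mul0r.
transitivity (\sum_y \sum_z (G y z - (z == y)%:R * G y z - (z == x)%:R * G y z
    - (y == x)%:R * G y z + 2 * ((y == x)%:R * ((z == x)%:R * G y z)))).
  apply: eq_bigr => y _; apply: eq_bigr => z _; rewrite (eq_sym z y).
  have [->|yx] := eqVneq y x; have [->|zx] := eqVneq z x; rewrite ?eqxx /=.
  - by ring.
  - by ring.
  - by rewrite (negbTE yx) /=; ring.
  - by case: eqP => _ /=; ring.
transitivity (\sum_y (\sum_z G y z - G y y - G y x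
    - (y == x)%:R * \sum_z G y z + 2 * ((y == x)%:R * G y x))).
  apply: eq_bigr => y _.
  by rewrite !big_split /= !sumrN !pick -!mulr_sumr !pick.
by rewrite !big_split /= !sumrN !pick -!mulr_sumr !pick.
Qed.

Section Plateaued.

Variables (R : rcfType) (n : nat) (f : boolfun n).
Implicit Types x y z : 'rV['F_2]_n.

(** Without its normalising factor the transform takes only the values 0, m and
- m with m = 2^((n + s) / 2), and t^3 = m^2 * t for each of them. *)
Lemma plateaued_cube s : plateaued R s f ->
  exists c : R, forall u,
    (\sum_z sgnF2 R (f z) * chi R u z) ^+ 3 = c * \sum_z sgnF2 R (f z) * chi R u z.
Proof.
move=> fP; exists ((pow2half R n * pow2half R s) ^+ 2) => u.
have p0 : pow2half R n != 0 by rewrite expf_neq0 // sqrtr_eq0 -ltNge ltr0n.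
have -> : \sum_z sgnF2 R (f z) * chi R u z = pow2half R n * fourier R f u.
  rewrite /fourier mulVKf //.
  by apply: eq_bigr => z _; rewrite -sgnF2D.
by have:= fP u; rewrite !inE => /or3P[] /eqP->; ring.
Qed.

(** The spectral identity of [plateaued_cube] read on the side of f: both members
are inverted and the factor 2^n is cancelled. *)
Lemma plateaued_convolution s : plateaued R s f ->
  exists c : R, forall x,
    \sum_y \sum_z sgnF2 R (f y) * sgnF2 R (f z) * sgnF2 R (f (x + y + z))
    = c * sgnF2 R (f x).
Proof.
move=> /plateaued_cube[c Wc]; exists c => x; apply: (mulfI (card_rV_neq0 R n)).
rewrite -(sum_chi3 (sgnF2 R \o f)) mulrCA -(sum_chi1 (sgnF2 R \o f)) mulr_sumr.
by apply: eq_bigr => u _; rewrite /= Wc mulrA.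
Qed.

(** The weight phi is expanded over the colour triples (a, b, d), and each
indicator through [eq_sgnF2]; the triple convolution is then the only part of
the sum that sees x. *)
Lemma plateaued_pattern_sum s (phi : 'F_2 -> 'F_2 -> 'F_2 -> R) x x' :
  plateaued R s f -> f x = f x' ->
  \sum_y \sum_z phi (f y) (f z) (f (x + y + z))
  = \sum_y \sum_z phi (f y) (f z) (f (x' + y + z)).
Proof.
move=> /plateaued_convolution[c Tc] fxx'.
have expand t : \sum_y \sum_z phi (f y) (f z) (f (t + y + z)) =
  \sum_a \sum_b \sum_d phi a b d / 8 *
    \sum_y \sum_z (1 + sgnF2 R a * sgnF2 R (f y)) *
                  (1 + sgnF2 R b * sgnF2 R (f z)) *
                  (1 + sgnF2 R d * sgnF2 R (f (t + y + z))).
  transitivity (\sum_y \sum_z \sum_a \sum_b \sum_d phi a b d *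
     ((a == f y)%:R * (b == f z)%:R * (d == f (t + y + z))%:R)).
    apply: eq_bigr => y _; apply: eq_bigr => z _.
    rewrite (bigD1 (f y)) //= [X in _ = _ + X]big1 ?addr0
      => [|a /negbTE ay];
      last first.
      by rewrite big1 // => b _; rewrite big1 // => d _; rewrite ay !mul0r mulr0.
    rewrite (bigD1 (f z)) //= [X in _ = _ + X]big1 ?addr0
      => [|b /negbTE bz];
      last first.
      by rewrite big1 // => d _; rewrite bz mulr0 mul0r mulr0.
    rewrite (bigD1 (f (t + y + z))) //= [X in _ = _ + X]big1 ?addr0
      => [|d /negbTE dv].
      by rewrite !eqxx !mulr1.
    by rewrite dv !mulr0.
  under eq_bigr => y _ do (rewrite exchange_big /=;
    under eq_bigr => a _ do (rewrite exchange_big /=;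
      under eq_bigr => b _ do rewrite exchange_big /=)).
  rewrite exchange_big /=; apply: eq_bigr => a _.
  rewrite exchange_big /=; apply: eq_bigr => b _.
  rewrite exchange_big /=; apply: eq_bigr => d _.
  rewrite mulr_sumr; apply: eq_bigr => y _.
  rewrite mulr_sumr; apply: eq_bigr => z _.
  by rewrite !eq_sgnF2; field.
rewrite !expand; apply: eq_bigr => a _; apply: eq_bigr => b _.
apply: eq_bigr => d _; congr (_ * _).
by rewrite !(sum_product_expand (sgnF2 R \o f)) /= !Tc fxx'.
Qed.

(** For a degenerate pair, x + y + z is x, y or z, so the correction terms involve
x only through f x. *)
Lemma plateaued_distinct_pattern_sum s (phi : 'F_2 -> 'F_2 -> 'F_2 -> R) x x' :
  plateaued R s f -> f x = f x' ->
  \sum_y \sum_z [&& y != x, z != x & y != z]%:R *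
     phi (f y) (f z) (f (x + y + z))
  = \sum_y \sum_z [&& y != x', z != x' & y != z]%:R *
     phi (f y) (f z) (f (x' + y + z)).
Proof.
move=> fP fxx'.
pose G t y z := phi (f y) (f z) (f (t + y + z)).
rewrite (sum_distinct_pairs (G x)) (sum_distinct_pairs (G x')) /G.
rewrite (plateaued_pattern_sum phi fP fxx').
have cancel_l t y : t + y + t = y by rewrite addrC addrA addvv add0r.
have cancel_r t y : t + y + y = t by rewrite -addrA addvv addr0.
congr (_ - _ - _ - _ + 2 * _).
- by apply: eq_bigr => y _; rewrite !cancel_r fxx'.
- by apply: eq_bigr => y _; rewrite !cancel_l fxx'.
- by apply: eq_bigr => y _; rewrite !addvv !add0r fxx'.
- by rewrite !addvv !add0r fxx'.
Qed.

End Plateaued.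

(** * Hyperedges through a vertex *)

Definition quad n (x y z : 'rV['F_2]_n) : {set 'rV['F_2]_n} :=
  [set x; y; z; x + y + z].

(** Since the four vectors add up to zero, two of them coincide exactly when the
other two do; so the conditions on x + y + z follow from those on x, y, z. *)
Lemma uniq_quad n (x y z : 'rV['F_2]_n) :
  uniq [:: x; y; z; x + y + z] = [&& y != x, z != x & y != z].
Proof.
rewrite /= !inE !negb_or.
have -> : (x == x + y + z) = (y == z).
  by rewrite -addrA -[X in X == _]addr0 (inj_eq (addrI x)) eq_sym addv_eq0.
have -> : (y == x + y + z) = (z == x).
  by rewrite (addrC x) -addrA -[X in X == _]addr0 (inj_eq (addrI y))
    eq_sym addv_eq0 eq_sym.
have -> : (z == x + y + z) = (y == x).
  by rewrite -[X in X == _]add0r (inj_eq (addIr z)) eq_sym addv_eq0 eq_sym.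
by rewrite (eq_sym x y) (eq_sym x z); do 3 case: (_ == _).
Qed.

Lemma enum_quad n (x y z : 'rV['F_2]_n) :
  [&& y != x, z != x & y != z] ->
  perm_eq (enum (quad x y z)) [:: x; y; z; x + y + z].
Proof.
rewrite -uniq_quad => U; apply: uniq_perm => //; first exact: enum_uniq.
by move=> t; rewrite mem_enum !inE -!orbA.
Qed.

Lemma quad_edge n (x y z : 'rV['F_2]_n) :
  [&& y != x, z != x & y != z] -> quad x y z \in subspace_hypergraph n.
Proof.
move=> d; have Pq := enum_quad d; rewrite inE cardE (perm_size Pq) eqxx /=.
rewrite -big_enum (perm_big _ Pq) !big_cons big_nil /= addr0.
by rewrite addrA [X in X == 0]addrA addvv.
Qed.

(** Three points of a hyperedge determine the fourth, as the sum is zero. This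
describes the fibre of (y, z) |-> quad x y z over e: the ordered pairs of
distinct points of e other than x. *)
Lemma quad_unique n (x y z : 'rV['F_2]_n) e :
  [&& y != x, z != x & y != z] -> e \in subspace_hypergraph n -> x \in e ->
  (quad x y z == e) = (y \in e) && (z \in e).
Proof.
move=> d; rewrite inE => /andP[/eqP card_e /eqP sum_e] xe.
apply/eqP/andP => [<-|[ye ze]]; first by rewrite !inE !eqxx !orbT.
pose T := [set x; y; z].
have UT : uniq [:: x; y; z].
  move: d; rewrite -uniq_quad -[X in uniq X]/(rcons [:: x; y; z] _).
  by rewrite rcons_uniq => /andP[].
have enT : perm_eq (enum T) [:: x; y; z].
  apply: uniq_perm => //; first exact: enum_uniq.
  by move=> t; rewrite mem_enum !inE -!orbA.
have sTe : T \subset e.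
  by apply/subsetP => t; rewrite !inE -orbA => /or3P[]/eqP->.
have /cards1P[w ew] : #|e :\: T| == 1%N.
  by rewrite cardsD (setIidPr sTe) card_e cardE (perm_size enT).
have wE : x + y + z = w.
  apply/eqP; rewrite -addv_eq0 -{}sum_e [\sum_(i in e) i](big_setID T) /=.
  rewrite (setIidPr sTe) ew big_set1 -big_enum (perm_big _ enT).
  by rewrite !big_cons big_nil /= addr0 !addrA.
(* Unfolded, quad x y z is T :|: [set x + y + z]. *)
by rewrite /quad wE -ew -[X in X :|: _ = _](setIidPr sTe) setID.
Qed.

(** Double counting of the triples (y, z, e) with e = quad x y z: a hyperedge e
through x is reached from 3 * 2 ordered pairs. *)
Lemma count_edges n (x : 'rV['F_2]_n) (P : pred {set 'rV['F_2]_n}) :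
  (\sum_y \sum_z ([&& y != x, z != x & y != z] && P (quad x y z)) =
   6 * #|[set e in subspace_hypergraph n | (x \in e) && P e]|)%N.
Proof.
set E := [set e in _ | _].
transitivity (\sum_y \sum_z \sum_(e in E)
    ([&& y != x, z != x & y != z] && (y \in e) && (z \in e)))%N.
  apply: eq_bigr => y _; apply: eq_bigr => z _.
  case: (boolP [&& _, _ & _]) => d /=; last by rewrite big1.
  transitivity (\sum_(e in E) (quad x y z == e))%N; last first.
    by apply: eq_bigr => e; rewrite inE => /and3P[eH xe _]; rewrite quad_unique.
  have [Pq|/negbTE nPq] := boolP (P _).
    rewrite (bigD1 (quad x y z)) /=; last by rewrite inE quad_edge //= Pq !inE eqxx.
    by rewrite eqxx big1 // => e /andP[_]; rewrite eq_sym => /negbTE->.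
  rewrite big1 // => e; rewrite inE => /and3P[_ _ Pe]; apply/eqP.
  by rewrite eqb0; apply: contraTneq Pe => <-; rewrite nPq.
under eq_bigr => y _ do rewrite exchange_big /=.
rewrite exchange_big /= mulnC -sum_nat_const; apply: eq_bigr => e.
rewrite inE => /andP[]; rewrite inE => /andP[/eqP card_e _] /andP[xe _].
have card_ex : #|e :\ x| = 3%N by have := cardsD1 x e; rewrite xe card_e => -[].
transitivity (\sum_(y in e :\ x) 2)%N; last by rewrite sum_nat_const card_ex.
rewrite [RHS]big_mkcond; apply: eq_bigr => y _; case: ifP => yex.
  have card_exy : #|e :\ x :\ y| = 2%N.
    by have := cardsD1 y (e :\ x); rewrite yex card_ex => -[].
  rewrite -[RHS]card_exy -sum1_card [RHS]big_mkcond; apply: eq_bigr => z _ /=.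
  move: yex; rewrite !inE => /andP[-> ->]; rewrite (eq_sym y) /=.
by case: (z != x); case: (z != y); case: (z \in e).
rewrite big1 // => z _; move: yex; rewrite !inE.
by case: (y != x) => //= ->; rewrite andbF.
Qed.

(** * Perfectness of the coloring *)

Lemma nonconstant_surj n (f : boolfun n) (c : 'F_2) :
  nonconstant f -> exists x, f x = c.
Proof.
move=> nc; have [/existsP[x /eqP]|/existsPn N] := boolP [exists x, f x == c].
  by exists x.
case: nc; exists (c + 1) => x; move: (N x).
by case: (F2P (f x)) => ->; case: (F2P c) => -> // _; apply/val_inj.
Qed.

Lemma color_range_quad n (f : boolfun n) (x y z : 'rV['F_2]_n) :
  [&& y != x, z != x & y != z] ->
  color_range f (quad x y z) = seq_mset [:: f x; f y; f z; f (x + y + z)].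
Proof. by move=> d; apply/eq_seq_msetP; exact: (perm_map f (enum_quad d)). Qed.

(** The count is made in R, where the Fourier identities live; it descends to nat
because the field has characteristic zero. *)
Lemma plateaued_edge_count (R : rcfType) n s (f : boolfun n)
    r (x x' : 'rV['F_2]_n) :
  plateaued R s f -> f x = f x' ->
  let edges t :=
    [set e in subspace_hypergraph n | (t \in e) && (color_range f e == r)] in
  #|edges x| = #|edges x'|.
Proof.
move=> fP fxx' edges.
pose phi a b d : R := (seq_mset [:: f x; a; b; d] == r)%:R.
have edgesE t : f t = f x -> (6 * #|edges t|)%:R =
    \sum_y \sum_z [&& y != t, z != t & y != z]%:R *
      phi (f y) (f z) (f (t + y + z)).
  move=> ft; rewrite -(count_edges t (fun e => color_range f e == r)).
  rewrite natr_sum; apply: eq_bigr => y _.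
  rewrite natr_sum; apply: eq_bigr => z _.
  case: (boolP [&& _, _ & _]) => d; rewrite ?mul0r // mul1r /=.
  by rewrite color_range_quad // ft.
have /eqP : (6 * #|edges x|)%:R = (6 * #|edges x'|)%:R :> R.
  by rewrite !edgesE //; apply: plateaued_distinct_pattern_sum fP fxx'.
by rewrite eqr_nat eqn_pmul2l // => /eqP.
Qed.

Theorem theorem7 (R : rcfType) (n s : nat) (f : boolfun n)
    (f_nonconst : nonconstant f) (f_plateaued : plateaued R s f) :
  perfect_coloring 2 (subspace_hypergraph n) f.
Proof.
split; first by split=> [|c]; [exact: card_Fp | exact: nonconstant_surj].
move=> x x' fxx'; apply/eq_seq_msetP/allP => r _ /=; apply/eqP.
have countE t : count_mem r
      [seq color_range f e | e <- enum [set e in subspace_hypergraph n | t \in e]]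
    = #|[set e in subspace_hypergraph n | (t \in e) && (color_range f e == r)]|.
  rewrite count_map -size_filter cardE; apply/perm_size/uniq_perm.
  - exact/filter_uniq/enum_uniq.
  - exact: enum_uniq.
  by move=> e; rewrite mem_filter !mem_enum !inE /= andbC andbA.
by rewrite !countE; apply: plateaued_edge_count f_plateaued fxx'.
Qed.
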